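(* For every integer $n\geqslant 5$, the convex polytope graph $D_n$ satisfies $$\gamma_{2\text{-SRD}}(D_n)=\left\lceil \frac{2|V(D_n)|}{3}\right\rceil=\left\lceil\frac{8n}{3}\right\rceil.$$
   Context: For $n\geqslant 5$, $D_n$ is the graph with vertex set $\{a_i,b_i,c_i,d_i : i\in\{0,\ldots,n-1\}\}$ ($4n$ distinct vertices) and edge set $\{a_ia_{i+1},\ d_id_{i+1},\ a_ib_i,\ b_ic_i,\ b_{i+1}c_i,\ c_id_i : i\in\{0,\ldots,n-1\}\}$, with indices taken modulo $n$. All graphs are finite, simple and undirected; $N(v)$ denotes the set of neighbors of $v$ and $\Delta(G)$ the maximum degree. Let $k\geqslant 1$ be an integer with $|V(G)|\geqslant k$. An attack pattern is a set $P\subseteq V(G)$ with $|P|=k$. A function $f:V(G)\to\{0,1,\ldots,\min(\Delta(G),k)+1\}$ is a proper $k$-SRD ($k$-strong Roman domination) function if for each attack pattern $P$ every vertex $u\in P$ with $f(u)=0$ can be defended by a neighboring vertex, where each vertex $v$ with $f(v)\geqslant 2$ can defend at most $f(v)-1$ of its neighbors in $P$ labeled 0 (and vertices with label $\leqslant 1$ defend no other vertex). That is, for each $P$ there is a map $\delta_P:\{u\in P : f(u)=0\}\to V(G)$ (which may depend on $P$) such that $\delta_P(u)\in N(u)$ and $f(\delta_P(u))\geqslant 2$ for all $u$ in its domain, and $|\delta_P^{-1}(v)|\leqslant f(v)-1$ for every $v$ with $f(v)\geqslant 2$. The weight is $\omega(f)=\sum_{v\in V(G)}f(v)$, and the $k$-SRD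 number is $\gamma_{k\text{-SRD}}(G)=\min\{\omega(f) : f \text{ is a proper } k\text{-SRD function on } G\}$. Here $k=2$. *)

(* Defs.v *)
From mathcomp Require Import all_boot all_order all_algebra.
Set Implicit Arguments.
Unset Strict Implicit.
Unset Printing Implicit Defensive.

Record sgraph := SGraph {
  vertex :> finType;
  adj : rel vertex;
  adj_sym : symmetric adj;
  adj_irr : irreflexive adj }.

Definition nbrs (G : sgraph) (v : G) : {set G} := [set w | adj v w].

Definition max_degree (G : sgraph) : nat := \max_(v : G) #|nbrs v|.

(* [k] and [G] are arbitrary; the notions are meaningful for 1 <= k <= #|G|. *)
Section StrongRomanDomination.
Variables (k : nat) (G : sgraph).

(* The ordinal type below is {0, ..., min (Delta G) k + 1}. *)
Definition labelling := {ffun G -> 'I_(minn (max_degree G) k).+2}.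

Definition weight (f : labelling) : nat := \sum_(v : G) f v.

Definition undefended (f : labelling) (P : {set G}) : {set G} :=
  [set u in P | f u == 0 :> nat].

(* [delta] is total, but only its restriction to [undefended f P] matters. *)
Definition is_defence (f : labelling) (P : {set G}) (delta : {ffun G -> G}) :=
  [forall u in undefended f P,
     (delta u \in nbrs u) && (2 <= f (delta u))] &&
  [forall v : G, (2 <= f v) ==>
     (#|[set u in undefended f P | delta u == v]| <= f v - 1)].

Definition proper_SRD (f : labelling) : bool :=
  [forall P : {set G}, (#|P| == k) ==>
     [exists delta : {ffun G -> G}, is_defence f P delta]].

(* The constant labelling 1 is proper, so the minimum is over a nonempty set. *)
Lemma proper_SRD_weight_exists :
  exists m, [exists f : labelling, proper_SRD f && (weight f == m)].
Proof.
pose f : labelling := [ffun=> inord 1].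
exists (weight f); apply/existsP; exists f; rewrite eqxx andbT.
apply/forallP => P; apply/implyP => _; apply/existsP; exists [ffun u => u].
have U0 : undefended f P = set0.
  by apply/setP => u; rewrite !inE ffunE inordK // andbF.
rewrite /is_defence U0; apply/andP; split; apply/forallP => v.
  by rewrite inE.
by apply/implyP => _; rewrite (eq_card (B := pred0)) ?card0 // => u; rewrite !inE.
Qed.

Definition SRD_number : nat := ex_minn proper_SRD_weight_exists.

End StrongRomanDomination.

Section ConvexPolytope.
Variable n : nat.

(* (0, i), (1, i), (2, i), (3, i) stand for a_i, b_i, c_i, d_i. *)
Definition Dvertex : finType := ('I_4 * 'I_n)%type.
Definition va (i : 'I_n) : Dvertex := (@Ordinal 4 0 isT, i).
Definition vb (i : 'I_n) : Dvertex := (@Ordinal 4 1 isT, i).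
Definition vc (i : 'I_n) : Dvertex := (@Ordinal 4 2 isT, i).
Definition vd (i : 'I_n) : Dvertex := (@Ordinal 4 3 isT, i).

(* [ordS i] is i + 1 modulo n. *)
Definition Dedge (x y : Dvertex) : bool :=
  [exists i : 'I_n,
     (x, y) \in [:: (va i, va (ordS i)); (vd i, vd (ordS i)); (va i, vb i);
                    (vb i, vc i); (vb (ordS i), vc i); (vc i, vd i)]].

(* [x != y] only discards the loops that occur when n = 1. *)
Definition Dadj (x y : Dvertex) : bool :=
  (x != y) && (Dedge x y || Dedge y x).

Lemma Dadj_sym : symmetric Dadj.
Proof. by move=> x y; rewrite /Dadj eq_sym orbC. Qed.

Lemma Dadj_irr : irreflexive Dadj.
Proof. by move=> x; rewrite /Dadj eqxx. Qed.

Definition convex_polytope_D : sgraph := SGraph Dadj_sym Dadj_irr.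

End ConvexPolytope.

(* Main.v *)
(* A labelling is proper for attacks on two vertices iff every vertex labelled 0
   has two neighbours labelled at least 2, or one labelled 3, or is the
   exclusive charge of a neighbour labelled 2, each of which has at most one
   such charge.  Lower bound, for any graph of maximum degree at most 3: a
   vertex labelled at least 2 keeps 2 units, sends 1 to each neighbour labelled
   0, and 1 more to its exclusive charges (to all of them if its label exceeds
   2); this costs at most three times its label, and every vertex ends up with
   at least 2 units.  Upper bound: the columns (a_i, b_i, c_i, d_i) labelled
   2000, 0202, 0020 and repeated cyclically give a proper labelling of weight 8
   per three columns, and any number of columns 1020, of weight 3, may be
   inserted between 0202 and 0020. *)
Require Import Defs.
From mathcomp Require Import all_boot all_order all_algebra.
From mathcomp Require Import zify.
Import GRing.Theory Num.Theory.
Set Implicit Arguments.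
Unset Strict Implicit.
Unset Printing Implicit Defensive.

(** * Attacks on two vertices in an arbitrary graph *)

Section TwoSRD.
Variable G : sgraph.
Implicit Types (f : labelling 2 G) (P : {set G}) (u v w : G).

Definition defenders f u : {set G} := [set w in nbrs u | 2 <= f w].

(** Capacity matters only when both attacked vertices use the same defender, which must then serve
    two and so carry a label above 2. *)
Lemma is_defence2P f P (delta : {ffun G -> G}) : #|P| = 2 ->
  reflect ({in undefended f P, forall u, delta u \in defenders f u} /\
           {in undefended f P &, forall u v,
              delta u = delta v -> u != v -> 2 < f (delta u)})
          (is_defence f P delta).
Proof.
move=> P2; apply: (iffP andP) => [[/forall_inP dN /forall_inP dC] | [dD dI]].
  have dD : {in undefended f P, forall u, delta u \in defenders f u}.
    by move=> u /dN /andP[Nu fu]; rewrite inE Nu.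
  split=> // u v Zu Zv Euv neq_uv.
  have /[!inE] /andP[_ f2] := dD u Zu.
  have := dC _ f2; set S := [set _ in _ | _].
  have : [set u; v] \subset S.
    by apply/subsetP=> x /set2P[] ->; rewrite inE ?Zu ?Zv ?Euv eqxx.
  move/subset_leq_card; rewrite cards2 neq_uv; lia.
split; first by apply/forall_inP=> u /dD; rewrite inE.
apply/forall_inP=> v fv.
set S := [set _ in _ | _].
have sSP : S \subset P by apply/subsetP=> x; rewrite !inE => /andP[/andP[]].
have [f3 | f2] := ltnP 2 (f v).
  by move/subset_leq_card: sSP; rewrite P2; lia.
suff : #|S| <= 1 by lia.
apply/card_le1_eqP => x y /setIdP[Zx /eqP dx] /setIdP[Zy /eqP dy].
apply/eqP; apply: contraTT f2 => neq_xy; rewrite -ltnNge -dx.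
by apply: (dI x y); rewrite // ?dx ?dy // eq_sym.
Qed.

(* [h w] is the only neighbour labelled 0 that a vertex [w] of label 2 may have
   to defend alone. *)
Definition has_exclusive_choice f (h : G -> G) : Prop :=
  forall u, f u = 0 :> nat ->
    1 < #|defenders f u| \/
    exists2 w, w \in defenders f u & 2 < f w \/ h w = u.

Lemma exclusive_choice_proper f h :
  has_exclusive_choice f h -> proper_SRD f.
Proof.
move=> hP.
have ne u : f u = 0 :> nat -> exists w, w \in defenders f u.
  by move/hP=> [/ltnW/card_gt0P // | [w wu _]]; exists w.
have two u v : f u = 0 :> nat -> 1 < #|defenders f v| ->
    exists2 wu, wu \in defenders f u & exists2 wv, wv \in defenders f v & wu != wv.
  move=> /ne[wu wuP] /card_gt1P[w1 [w2 [w1P w2P neq12]]]; exists wu => //.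
  by case: (eqVneq wu w1) => [-> | ?]; [exists w2 | exists w1].
(* A vertex with two defenders can avoid the one used by the other vertex. Otherwise a shared
   defender of label 2 would be sent by [h] to both [u] and [v]. *)
have pair u v : u != v -> f u = 0 :> nat -> f v = 0 :> nat ->
    exists2 wu, wu \in defenders f u &
    exists2 wv, wv \in defenders f v & (wu == wv) ==> (2 < f wu).
  move=> neq_uv fu0 fv0.
  case: (hP u fu0) => [u2 | [wu wuP hu]].
    have [wv ? [wu ? neq]] := two v u fv0 u2.
    by exists wu => //; exists wv; rewrite // eq_sym (negbTE neq).
  case: (hP v fv0) => [v2 | [wv wvP hv]].
    have [{hu wuP}wu ? [wv ? neq]] := two u v fu0 v2.
    by exists wu => //; exists wv; rewrite // (negbTE neq).
  exists wu => //; exists wv => //; apply/implyP=> /eqP E.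
  case: hu => // hu; case: hv => [|hv]; first by rewrite E.
  by move: neq_uv; rewrite -hu -hv E eqxx.
apply/forallP=> P; apply/implyP=> /eqP P2; apply/existsP.
have /cards2P[a [b [neq_ab defP]]] : #|P| == 2 by rewrite P2.
have [/andP[/eqP fa0 /eqP fb0] | nz] :=
    boolP ((f a == 0 :> nat) && (f b == 0 :> nat)).
  have [wa waP [wb wbP wab]] := pair a b neq_ab fa0 fb0.
  exists [ffun x => if x == a then wa else wb]; apply/is_defence2P => //.
  have ba : (b == a) = false by rewrite eq_sym (negbTE neq_ab).
  split=> [x | x y] /setIdP[].
    by rewrite defP => /set2P[] -> _; rewrite ffunE ?eqxx ?ba.
  rewrite defP => /set2P[] -> _ /setIdP[/set2P[] -> _]; rewrite !ffunE ?eqxx ?ba // => E.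
    by rewrite E eqxx in wab *.
  by rewrite E eqxx in wab *.
exists [ffun x => odflt x [pick w in defenders f x]]; apply/is_defence2P => //.
split=> [x /setIdP[_ /eqP/ne[w wx]] | x y /setIdP[]].
  by rewrite ffunE; case: pickP => [w' // | /(_ w)]; rewrite wx.
rewrite defP => /set2P[] -> fx /setIdP[/set2P[] -> fy];
  by rewrite ?eqxx // fx fy in nz *.
Qed.

Lemma proper_exclusive_choice f :
  1 < #|G| -> proper_SRD f -> exists h, has_exclusive_choice f h.
Proof.
move=> G2 /forallP fP.
have defence u v : u != v ->
    exists delta, is_defence f [set u; v] delta /\ #|[set u; v]| = 2.
  move=> neq; have /implyP := fP [set u; v]; rewrite cards2 neq => /(_ isT).
  by case/existsP=> delta; exists delta.
(* [h w] is some vertex labelled 0 whose sole defender is [w]; where the choice is used, one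
   exists. *)
exists (fun w => odflt w [pick u | (f u == 0 :> nat) && (defenders f u == [set w])]).
move=> u fu0; have [//| u1] := ltnP 1 #|defenders f u|; [by left | right].
(* Only a second vertex completes [u] to an attack pattern. *)
have [v neq_uv] : exists v, u != v.
  have /card_gt1P[x [y [_ _ neq]]] := G2.
  by case: (eqVneq u x) => [-> | ?]; [exists y | exists x].
have [delta [/is_defence2P dP /dP[dD _]]] := defence u v neq_uv.
have Zu w : u \in undefended f [set u; w] by rewrite !inE eqxx fu0.
have wu := dD u (Zu v); set w := delta u in wu.
have defu : defenders f u = [set w].
  by apply/esym/eqP; rewrite eqEcard sub1set wu cards1.
exists w => //; case: pickP => [x /andP[/eqP fx0 /eqP defx] /= | /(_ u)]; last first.
  by rewrite fu0 defu !eqxx.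
have [-> | neq_ux] := eqVneq x u; [by right | left].
rewrite eq_sym in neq_ux.
(* If [w] is also the sole defender of [x], attacking [u] and [x] together makes [w] serve both, so
   its label exceeds 2. *)
have [d [/is_defence2P d'P /d'P[d'D d'I]]] := defence u x neq_ux.
have Zx : x \in undefended f [set u; x] by rewrite !inE eqxx fx0 orbT.
have := d'D u (Zu x); have := d'D x Zx; rewrite defu defx !inE => /eqP dx /eqP du.
by rewrite -du; apply: d'I (Zu x) Zx _ neq_ux; rewrite dx du.
Qed.

Lemma weight_lower_bound f :
    1 < #|G| -> max_degree G <= 3 -> proper_SRD f ->
  2 * #|G| <= 3 * weight f.
Proof.
move=> G2 deg3 /(proper_exclusive_choice G2)[h hP].
(* [own v] is what [v] keeps and [c w u] what [w] sends to [u]. A vertex labelled 1 also keeps 2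
   units, but sends none. *)
pose own v := if f v == 0 :> nat then 0 else 2.
pose c w u := if (f u == 0 :> nat) && (w \in defenders f u)
              then 1 + ((2 < f w) || (h w == u)) else 0.
have recv u : 2 <= own u + \sum_w c w u.
  rewrite /own; case: eqP => // fu0; rewrite add0n.
  have cE w : w \in defenders f u -> c w u = 1 + ((2 < f w) || (h w == u)).
    by move=> wu; rewrite /c fu0 eqxx wu.
  case: (hP u fu0) => [u2 | [w wu hw]].
    apply: leq_trans u2 _; rewrite -sum1_card big_mkcond /=.
    by apply: leq_sum => w _; case: ifP => // /cE ->.
  rewrite (bigD1 w) //= cE //.
  by case: hw => [-> // | ->]; rewrite eqxx orbT.
have give w : own w + \sum_u c w u <= 3 * f w.
  have N3 : #|nbrs w| <= 3 by apply: leq_trans deg3; apply: (leq_bigmax w).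
  have cN u : c w u <= if u \in nbrs w then (if 2 < f w then 2 else 1 + (h w == u)) else 0.
    rewrite /c; case: andP => // -[_]; rewrite !inE adj_sym => /andP[-> _].
    by case: ltnP.
  have {cN}: \sum_u c w u <= \sum_(u in nbrs w) if 2 < f w then 2 else 1 + (h w == u).
    by rewrite [X in _ <= X]big_mkcond; apply: leq_sum.
  (* Label 1 costs 2, at most 3; a label above 2 costs at most 2 + 3 * 2 = 8, at most 9; label 2
     costs at most 2 + 3 + 1 = 6, since [h] names a single charge. *)
  rewrite /own; case: (ltngtP (f w) 2) => [f1 | f3 | f2].
  - rewrite [\sum_u _]big1 => [|u _]; last first.
      by rewrite /c !inE [2 <= _]leqNgt f1 !andbF.
    by case: eqP => // /eqP; rewrite -lt0n; lia.
  - by rewrite sum_nat_const; case: eqP; lia.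
  rewrite big_split sum1_card f2 /=.
  suff : \sum_(u in nbrs w) (h w == u : nat) <= 1 by lia.
  apply: (@leq_trans (\sum_u (h w == u))).
    by rewrite big_mkcond; apply: leq_sum => u _; case: ifP.
  by rewrite (bigD1 (h w)) //= eqxx big1 // => u; rewrite eq_sym => /negbTE->.
(* Double counting: the units given, summed over all vertices, are the units received. *)
rewrite /weight big_distrr /=.
apply: leq_trans (leq_sum _ (fun w _ => give w)).
by rewrite big_split exchange_big -big_split mulnC -sum_nat_const; apply: leq_sum.
Qed.

End TwoSRD.

(** * The graph [D] and its labellings by columns *)

Section PolytopeD.
Variable n : nat.
Hypothesis n_gt1 : 1 < n.
Local Notation D := (convex_polytope_D n).
Implicit Types (v : D) (i : 'I_n).

Lemma Dvertex_ind (P : D -> Prop) :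
    (forall i, P (va i)) -> (forall i, P (vb i)) ->
    (forall i, P (vc i)) -> (forall i, P (vd i)) ->
  forall v, P v.
Proof.
move=> Pa Pb Pc Pd [[[|[|[|[|//]]]] r4] i]; rewrite (bool_irrelevance r4 isT).
- exact: Pa.
- exact: Pb.
- exact: Pc.
- exact: Pd.
Qed.

Lemma card_D : #|D| = 4 * n.
Proof. by rewrite card_prod !card_ord. Qed.

Lemma max_degree_D_le : max_degree D <= 3.
Proof.
have sz v (s : seq D) : size s <= 3 -> {subset nbrs v <= s} -> #|nbrs v| <= 3.
  move=> s3 /subsetP/subset_leq_card Ns.
  exact: leq_trans (leq_trans Ns (card_size s)) s3.
apply/bigmax_leqP => v _;
elim/Dvertex_ind: v => i;
  [ apply: (sz _ [:: va (ordS i); va (ord_pred i); vb i])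
  | apply: (sz _ [:: va i; vc i; vc (ord_pred i)])
  | apply: (sz _ [:: vb i; vb (ordS i); vd i])
  | apply: (sz _ [:: vd (ordS i); vd (ord_pred i); vc i]) ] => // w;
  rewrite inE /= => /andP[_ /orP[]] /existsP[j]; rewrite /in_mem /=;
  do 6 ?[case/orP]; rewrite // => /eqP[] *; subst;
  by rewrite ?ordSK ?eqxx ?orbT.
Qed.

(** Ensures that the edges along the rows a and d are not loops, so that [Dadj] retains them. *)
Lemma ordS_neq i : ordS i != i.
Proof.
apply/eqP => /(congr1 val) /=; have := ltn_ord i.
case: (ltngtP i.+1 n) => // [lt|E] _; first by rewrite modn_small //; lia.
by rewrite E modnn; lia.
Qed.

Lemma adj_Dedge (x y : D) : x != y -> Dedge x y -> adj x y /\ adj y x.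
Proof. by move=> neq xy; rewrite /= /Dadj (eq_sym y) neq xy orbT. Qed.

Lemma adj_aa i : adj (va i : D) (va (ordS i)) /\ adj (va (ordS i) : D) (va i).
Proof.
apply: adj_Dedge; first by rewrite xpair_eqE /= eq_sym ordS_neq.
by apply/existsP; exists i; rewrite !inE eqxx.
Qed.

Lemma adj_dd i : adj (vd i : D) (vd (ordS i)) /\ adj (vd (ordS i) : D) (vd i).
Proof.
apply: adj_Dedge; first by rewrite xpair_eqE /= eq_sym ordS_neq.
by apply/existsP; exists i; rewrite !inE eqxx !orbT.
Qed.

Lemma adj_ab i : adj (va i : D) (vb i) /\ adj (vb i : D) (va i).
Proof.
by apply: adj_Dedge => //; apply/existsP; exists i; rewrite !inE eqxx !orbT.
Qed.

Lemma adj_bc i : adj (vb i : D) (vc i) /\ adj (vc i : D) (vb i).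
Proof.
by apply: adj_Dedge => //; apply/existsP; exists i; rewrite !inE eqxx !orbT.
Qed.

Lemma adj_bSc i : adj (vb (ordS i) : D) (vc i) /\ adj (vc i : D) (vb (ordS i)).
Proof.
by apply: adj_Dedge => //; apply/existsP; exists i; rewrite !inE eqxx !orbT.
Qed.

Lemma adj_cd i : adj (vc i : D) (vd i) /\ adj (vd i : D) (vc i).
Proof.
by apply: adj_Dedge => //; apply/existsP; exists i; rewrite !inE eqxx !orbT.
Qed.

(** Makes 2 an admissible label, so that [inord] does not alter the column labels. *)
Lemma max_degree_D_gt0 : 0 < max_degree D.
Proof.
pose i0 := Ordinal (ltnW n_gt1).
apply: leq_trans (leq_bigmax (va i0 : D)).
by apply/card_gt0P; exists (vb i0); rewrite inE (adj_ab i0).1.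
Qed.

(* Four column types [x], each listing its labels in the rows a, b, c, d. *)
Definition column_label (x r : nat) : nat :=
  nth 0 (nth [::] [:: [:: 2; 0; 0; 0]; [:: 0; 2; 0; 2];
                      [:: 0; 0; 2; 0]; [:: 1; 0; 2; 0]] x) r.

(** The transitions inside and between blocks 0, 1, 3, ..., 3, 2 with any number of 3s. *)
Definition column_step (x y : nat) : bool :=
  (x, y) \in [:: (0, 1); (1, 2); (1, 3); (3, 3); (3, 2); (2, 0)].

Definition column_labelling (s : 'I_n -> nat) : labelling 2 D :=
  [ffun v : 'I_4 * 'I_n => inord (column_label (s v.2) v.1)].

Lemma column_labellingE s (v : 'I_4 * 'I_n) :
  column_labelling s v = column_label (s v.2) v.1 :> nat.
Proof.
rewrite ffunE inordK // ltnS (@leq_trans 2) //; last first.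
  by rewrite ltnS leq_min max_degree_D_gt0.
case: v => [[r r4] i] /=; rewrite /column_label.
case: r {r4} => [|[|[|[|r]]]]; case: (s i) => [|[|[|[|x]]]] //=;
  by rewrite ?nth_nil //.
Qed.

Lemma column_labelling_proper s :
  (forall i, column_step (s i) (s (ordS i))) -> proper_SRD (column_labelling s).
Proof.
move=> stepS.
have around i : [\/ [/\ s (ord_pred i) = 2, s i = 0 & s (ordS i) = 1],
                    s (ord_pred i) = 0 /\ s i = 1,
                    (s (ord_pred i) = 1 \/ s (ord_pred i) = 3) /\ s i = 3 |
                    [/\ s (ord_pred i) = 1 \/ s (ord_pred i) = 3, s i = 2
                      & s (ordS i) = 0]].
  have := stepS i; have := stepS (ord_pred i); rewrite ord_predK.
  rewrite /column_step !inE !xpair_eqE.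
  case: (s (ord_pred i)) => [|[|[|[|x]]]]; case: (s i) => [|[|[|[|y]]]] //= _;
    move=> E; try (by constructor; auto); by constructor; split; auto; lia.
(* The 2s in rows a, b and d look after the previous column. For a 2 at [vc i] the charge depends on
   that column: after type 1, [vd i] also has [vd (ord_pred i)] and [vb i] is exclusive; after type
   3, [vb i] also has [vc (ord_pred i)] and [vd i] is exclusive. *)
pose h (v : 'I_4 * 'I_n) : D :=
  if v.1 == 0 :> nat then va (ord_pred v.2) else
  if v.1 == 1 :> nat then vc (ord_pred v.2) else
  if v.1 == 3 :> nat then vd (ord_pred v.2) else
  if s (ord_pred v.2) == 1 then vb v.2 else vd v.2.
apply: (@exclusive_choice_proper D _ h).
set f := column_labelling s.
have defP (u : D) (w : 'I_4 * 'I_n) :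
    adj u (w : D) -> 1 < column_label (s w.2) w.1 -> w \in defenders f u.
  by move=> uw fw; rewrite !inE uw column_labellingE.
have two (u : D) (w w' : 'I_4 * 'I_n) : adj u (w : D) -> adj u (w' : D) ->
    [&& w != w', 1 < column_label (s w.2) w.1 & 1 < column_label (s w'.2) w'.1] ->
    1 < #|defenders f u|.
  by move=> uw uw' /and3P[? ? ?]; apply/card_gt1P; exists w, w'; split=> //; apply: defP.
have one (u : D) (w : 'I_4 * 'I_n) : adj u (w : D) ->
    1 < column_label (s w.2) w.1 -> h w = u ->
    exists2 w', w' \in defenders f u & 2 < f w' \/ h w' = u.
  by move=> uw sw hw; exists w; [apply: defP | right].
have aP i : adj (va i : D) (va (ord_pred i)).
  by have [_] := adj_aa (ord_pred i); rewrite ord_predK.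
have bP i : adj (vb i : D) (vc (ord_pred i)).
  by have [+ _] := adj_bSc (ord_pred i); rewrite ord_predK.
have dP i : adj (vd i : D) (vd (ord_pred i)).
  by have [_] := adj_dd (ord_pred i); rewrite ord_predK.
have predN i : i != ord_pred i by rewrite -{1}(ord_predK i) ordS_neq.
have [aS dS] := ((fun i => (adj_aa i).1), (fun i => (adj_dd i).1)).
have [ab ba] := ((fun i => (adj_ab i).1), (fun i => (adj_ab i).2)).
have [bc cb] := ((fun i => (adj_bc i).1), (fun i => (adj_bc i).2)).
have [cd dc] := ((fun i => (adj_cd i).1), (fun i => (adj_cd i).2)).
have cbS i := (adj_bSc i).2.
(* The ten zeros of the four column types, row by row. *)
elim/Dvertex_ind => i; rewrite column_labellingE /=;
  case: (around i) => [[sp si sS]|[sp si]|[sp si]|[sp si sS]]; rewrite si // => _.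
- by left; apply: two (aP i) (ab i) _; rewrite /= sp si.
- by right; apply: one (aS i) _ _; rewrite /h /= ?sS ?ordSK.
- by left; apply: two (ba i) (bP i) _; rewrite /= sp si.
- case: sp => sp; first by right; apply: one (bc i) _ _; rewrite /h /= ?sp ?si.
  by left; apply: two (bc i) (bP i) _; rewrite xpair_eqE /= predN sp si.
- case: sp => sp; first by right; apply: one (bc i) _ _; rewrite /h /= ?sp ?si.
  by left; apply: two (bc i) (bP i) _; rewrite xpair_eqE /= predN sp si.
- by right; apply: one (cbS i) _ _; rewrite /h /= ?sS ?ordSK.
- by left; apply: two (cb i) (cd i) _; rewrite /= si.
- by right; apply: one (dS i) _ _; rewrite /h /= ?sS ?ordSK.
- case: sp => sp; last by right; apply: one (dc i) _ _; rewrite /h /= ?sp ?si.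
  by left; apply: two (dc i) (dP i) _; rewrite /= sp si.
- case: sp => sp; last by right; apply: one (dc i) _ _; rewrite /h /= ?sp ?si.
  by left; apply: two (dc i) (dP i) _; rewrite /= sp si.
Qed.

Lemma weight_column_labelling s :
  weight (column_labelling s) =
    \sum_(i < n) \sum_(r < 4) column_label (s i) r.
Proof.
rewrite exchange_big pair_bigA; apply: eq_bigr => v _.
exact: column_labellingE.
Qed.

End PolytopeD.

(* The columns are of types 0, 1, 2 periodically, with [n %% 3] columns of
   type 3 inserted just before the last one. *)
Definition column_type (n i : nat) : nat :=
  if i < n %/ 3 * 3 - 1 then i %% 3 else if i.+1 < n then 3 else 2.

Lemma column_type_step n (i : 'I_n) :
  2 < n -> column_step (column_type n i) (column_type n (ordS i)).
Proof.
move=> n3; have q0 : 0 < n %/ 3 by rewrite divn_gt0.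
have in_q := leq_divM n 3.
case: i => i lt_in /=; rewrite /column_type /=.
have [En | neq_in] := eqVneq i.+1 n.
  (* Wrap-around: the last column has type 2 and column 0 has type 0. *)
  rewrite En modnn ltnn.
  have -> : (n <= n %/ 3 * 3 - 1) = false by lia.
  by have -> : 0 < n %/ 3 * 3 - 1 by lia.
have lt_i1n : i.+1 < n by lia.
rewrite (modn_small lt_i1n) lt_i1n.
have [lt_i1 | ge_i1] := ltnP i.+1 (n %/ 3 * 3 - 1).
  rewrite ifT; last by lia.
  have : i %% 3 < 3 by rewrite ltn_mod.
  by rewrite -[i.+1]addn1 -modnDml; case: (i %% 3) => [|[|[|]]].
(* Either [i] is the last column of the periodic stretch, hence of type 1, or it has type 3; the
   next column has type 3 or 2. *)
case: ltnP => lt_i; last by case: ifP.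
have -> : i %% 3 = 1 by lia.
by case: ifP.
Qed.

Lemma sum_periodic_columns m :
  \sum_(0 <= i < m * 3) \sum_(r < 4) column_label (i %% 3) r = 8 * m.
Proof.
have W k j : \sum_(r < 4) column_label ((k * 3 + j) %% 3) r =
             \sum_(r < 4) column_label (j %% 3) r by rewrite modnMDl.
elim: m => [|m IH]; first by rewrite big_geq.
rewrite (_ : m.+1 * 3 = (m * 3).+3) ?mulSn // !big_nat_recr //= IH.
rewrite -[(m * 3).+2]addn2 -[(m * 3).+1]addn1 -{1}[m * 3]addn0 !W.
rewrite !big_ord_recr !big_ord0; change (8 * m + 2 + 4 + 2 = 8 * m.+1); lia.
Qed.

(** For n = 3q + r with r at most 2 the weight is 8q + 3r, and three times this is 8n + r. *)
Lemma D_upper_bound n : 2 < n ->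
  exists2 f : labelling 2 (convex_polytope_D n), proper_SRD f
    & 3 * weight f <= 8 * n + 2.
Proof.
move=> n3; have n_gt1 := ltnW n3.
exists (column_labelling (fun i => column_type n i)).
  by apply: column_labelling_proper => // i; apply: column_type_step.
rewrite weight_column_labelling //.
rewrite -(big_mkord xpredT (fun i => \sum_(r < 4) column_label (column_type n i) r)).
have q0 : 0 < n %/ 3 by rewrite divn_gt0.
have in_q := leq_divM n 3.
case: n => // n in n3 n_gt1 q0 in_q *.
(* The final column of the last period, of type 2, is split off: in the labelling it stands at the
   very end, after the columns of type 3. *)
have Eq : n.+1 %/ 3 * 3 = (n.+1 %/ 3 * 3 - 1).+1 by lia.
have := sum_periodic_columns (n.+1 %/ 3); rewrite Eq.
set q1 := n.+1 %/ 3 * 3 - 1 in Eq *; rewrite big_nat_recr //= => period.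
have q1n : q1 <= n by lia.
rewrite big_nat_recr //= (big_cat_nat (leq0n q1) q1n) /=.
rewrite (eq_big_nat _ _ (F2 := fun i => \sum_(r < 4) column_label (i %% 3) r));
  last by move=> i /andP[_ lt_i]; rewrite /column_type -/q1 lt_i.
rewrite [X in _ + X + _](eq_big_nat _ _ (F2 := fun=> 3)); last first.
  move=> i /andP[le_i lt_i]; rewrite /column_type -/q1 ltnNge le_i /= ltnS lt_i.
  by rewrite !big_ord_recr big_ord0.
rewrite sum_nat_const_nat.
have q1_mod : q1 %% 3 = 2 by lia.
move: period; rewrite q1_mod.
have -> : column_type n.+1 n = 2.
  by rewrite /column_type -/q1 ltnn; case: ifP => //; lia.
rewrite !big_ord_recr !big_ord0 /=; lia.
Qed.

(** * From the two bounds to the ceiling *)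

Local Open Scope ring_scope.

Theorem proposition1 (n : nat) (hn : (5 <= n)%N) :
  (SRD_number 2 (convex_polytope_D n))%:Z
    = Num.ceil (2%:R * #|convex_polytope_D n|%:R / 3%:R : rat) /\
  Num.ceil (2%:R * #|convex_polytope_D n|%:R / 3%:R : rat)
    = Num.ceil (8%:R * n%:R / 3%:R : rat).
Proof.
have -> : 2%:R * #|convex_polytope_D n|%:R / 3%:R = 8%:R * n%:R / 3%:R :> rat.
  by rewrite card_D natrM mulrA -natrM.
split=> //; rewrite /SRD_number; case: ex_minnP => m.
case/existsP=> f /andP[fP /eqP <-] min_f.
have lower : (8 * n <= 3 * weight f)%N.
  have := weight_lower_bound _ _ fP; rewrite card_D => H.
  have {H} := H _ (max_degree_D_le n); lia.
have upper : (3 * weight f <= 8 * n + 2)%N.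
  have [g gP gw] := @D_upper_bound n (ltnW (ltnW hn)).
  have : (weight f <= weight g)%N by apply/min_f/existsP; exists g; rewrite gP eqxx.
  lia.
(* By integrality [upper] is 3w < 8n + 3 for the weight w, so with [lower] it gives w - 1 < 8n/3 <=
   w. *)
apply/esym/ceil_def.
have t3 : (0 : rat) < 3%:R by [].
rewrite rmorphB /= ltrBlDr -(ltr_pM2r t3) mulrDl divfK // ler_pdivrMr // mul1r.
by rewrite -!natrM -natrD ltr_nat ler_nat; apply/andP; split; lia.
Qed.
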